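(* For $s\in\{1,2\}$ let $G_n^{2,s}$ be the graph obtained from $n$ disjoint $4$-cycles, the $i$-th having vertices $v_{i,1},v_{i,2},v_{i,3},v_{i,4}$ and edges $v_{i,1}v_{i,2},v_{i,2}v_{i,3},v_{i,3}v_{i,4},v_{i,1}v_{i,4}$, by adding the edge $v_{i,s+1}v_{i+1,1}$ for $i=1,\dots,n-1$. Then $$\lim_{n\to\infty}\mathcal{I}(G_n^{2,1})=\frac{6r^2+r+10}{2(3r^2+2r+6)},\qquad r=1+\sqrt[3]{\frac{45+\sqrt{1257}}{18}}+\sqrt[3]{\frac{45-\sqrt{1257}}{18}},$$ and $$\lim_{n\to\infty}\mathcal{I}(G_n^{2,2})=\frac{5r'+6}{2(3r'+4)},\qquad r'=\frac{3+\sqrt{17}}{2}.$$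
   Context: For a finite simple graph $G$: a matching is a set of pairwise vertex-disjoint edges; it is maximal if not contained in a larger matching. $\nu(G)$ is the maximum matching size, $\mathcal{T}_0(G)$ the number of maximal matchings, $\mathcal{T}_1(G)$ the sum of the sizes of all maximal matchings, and $\mathcal{I}(G)=\frac{\mathcal{T}_1(G)}{\nu(G)\mathcal{T}_0(G)}$ (equal to $1$ by convention if $\nu(G)=0$). *)

(* Defs.v *)
From mathcomp Require Import all_boot all_order all_algebra.
From mathcomp Require Import reals.
Set Implicit Arguments.
Unset Strict Implicit.
Unset Printing Implicit Defensive.
Import Order.TTheory GRing.Theory Num.Theory.

Record sgraph := SGraph {
  vertex :> finType;
  adj : rel vertex;
  adj_sym : symmetric adj;
  adj_irr : irreflexive adj }.

Definition edges (G : sgraph) : {set {set G}} :=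
  [set e : {set G} | [exists x, exists y, adj x y && (e == [set x; y])]].

Definition matching (G : sgraph) (M : {set {set G}}) : bool :=
  (M \subset edges G) && trivIset M.

Definition maximal_matching (G : sgraph) (M : {set {set G}}) : bool :=
  maxset (@matching G) M.

Definition nu (G : sgraph) : nat :=
  \max_(M : {set {set G}} | matching M) #|M|.

Definition T0 (G : sgraph) : nat :=
  #|[set M : {set {set G}} | maximal_matching M]|.

Definition T1 (G : sgraph) : nat :=
  \sum_(M : {set {set G}} | maximal_matching M) #|M|.

(* The invariant I(G). *)
Definition avg_ratio (R : realType) (G : sgraph) : R :=
  if nu G == 0 then 1%R else ((T1 G)%:R / ((nu G)%:R * (T0 G)%:R))%R.

(* All indices are shifted down by one: (i, j) stands for the vertex
   v_{i+1,j+1}.  Each edge is listed in one orientation only. *)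
Definition C4chain_arc (s n : nat) (u v : 'I_n * 'I_4) : bool :=
  (u.1 == v.1) &&
    ((u.2 : nat, v.2 : nat) \in [:: (0, 1); (1, 2); (2, 3); (0, 3)])
  || [&& u.1.+1 == v.1, u.2 == s :> nat & v.2 == 0 :> nat].

Definition C4chain_adj (s n : nat) : rel ('I_n * 'I_4) :=
  fun u v => C4chain_arc s u v || C4chain_arc s v u.

Lemma C4chain_adj_sym (s n : nat) : symmetric (@C4chain_adj s n).
Proof. by move=> u v; rewrite /C4chain_adj orbC. Qed.

Lemma C4chain_adj_irr (s n : nat) : irreflexive (@C4chain_adj s n).
Proof.
move=> [i j]; rewrite /C4chain_adj orbb /C4chain_arc /= eqxx /=.
rewrite gtn_eqF // orbF.
by case: j => [] [|[|[|[|]]]].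
Qed.

(* The graph G_n^{2,s}. *)
Definition C4chain (s n : nat) : sgraph :=
  SGraph (@C4chain_adj_sym s n) (@C4chain_adj_irr s n).

(* Main.v *)
(** Cutting the chain between consecutive 4-cycles turns a set of edges into a word
    whose letters record the edges of one cycle and of the link leaving it, and
    maximality of a matching becomes a condition on consecutive letters.  Hence the
    polynomials [Z n], the sums of [x ^ #|M|] over the maximal matchings [M], satisfy
    a linear recurrence in [n] with characteristic polynomial [chi x] over the
    polynomials in [x].  As [Z n] at 1 counts the maximal matchings and [(Z n)'] at 1
    adds up their sizes, everything follows from the recurrence at [x = 1] and its
    derivative there: the real root [r] of [chi 1] dominates the others, the second
    sequence is resonantly forced by the first, and their ratio grows like [n] times
    the logarithmic derivative at 1 of the root branch through [r], which is
    [- (d chi / d x) / (r (d chi / d lambda))] at [(1, r)].  Finally [nu = 2 n]. *)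

Require Import Defs.
From HB Require Import structures.
From mathcomp Require Import all_classical all_reals all_analysis.
From mathcomp Require Import all_boot all_order all_algebra zify ring lra.
Set Implicit Arguments.
Unset Strict Implicit.
Unset Printing Implicit Defensive.
Import Order.TTheory GRing.Theory Num.Theory.
Import numFieldNormedType.Exports.

Section MaximalMatchings.
Variable G : sgraph.
Implicit Types (M : {set {set G}}) (e : {set G}) (v x y : G).

Definition degree M v : nat := #|[set e in M | v \in e]|.

Lemma degree_gt0 M v : (0 < degree M v) = (v \in cover M).
Proof.
rewrite card_gt0; apply/set0Pn/bigcupP => [[e]|[e eM ve]].
  by rewrite inE => /andP[eM ve]; exists e.
by exists e; rewrite inE eM.
Qed.

Lemma mem_edgesP e :
  reflect (exists2 xy : G * G, adj xy.1 xy.2 & e = [set xy.1; xy.2]) (e \in edges G).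
Proof.
rewrite inE; apply: (iffP existsP) => [[x /existsP[y /andP[xy /eqP->]]]|].
  by exists (x, y).
by case=> -[x y] /= xy ->; exists x; apply/existsP; exists y; rewrite xy eqxx.
Qed.

Lemma card_edge e : e \in edges G -> #|e| = 2.
Proof.
case/mem_edgesP => -[x y] /= xy ->; rewrite cards2.
by have [xey|//] := eqVneq x y; rewrite xey adj_irr in xy.
Qed.

Lemma card_matching_le M : matching M -> #|M|.*2 <= #|G|.
Proof.
case/andP => /subsetP ME /eqP tM.
rewrite (leq_trans _ (max_card (mem (cover M)))) // -tM.
by rewrite (eq_bigr (fun=> 2)) ?sum_nat_const ?muln2 // => e /ME /card_edge.
Qed.

Lemma matching_degreeE M :
  matching M = (M \subset edges G) && [forall v, degree M v <= 1].
Proof.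
congr (_ && _); apply/trivIsetP/forallP => [tM v|M1 A B AM BM].
  apply/card_le1_eqP => A B; rewrite !inE => /andP[AM vA] /andP[BM vB].
  by apply: contraTeq vA => BA; rewrite (disjointFr (tM B A BM AM BA) vB).
apply: contraR => /pred0Pn[v /andP[/= vA vB]].
by apply/eqP; apply: (card_le1_eqP (M1 v)); rewrite !inE ?AM ?BM.
Qed.

Lemma matching_setU1 M x y : matching M -> adj x y ->
  x \notin cover M -> y \notin cover M -> matching ([set x; y] |: M).
Proof.
case/andP => ME tM xy xM yM; apply/andP; split.
  by rewrite subUset ME andbT sub1set; apply/mem_edgesP; exists (x, y).
apply: proj1 (trivIsetU1 _ tM _) => [e eM|].
  rewrite disjoints_subset; apply/subsetP => z; rewrite !inE.
  have Me : {subset e <= cover M} by apply/subsetP; apply: bigcup_sup.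
  by case/orP => /eqP->; [apply: contra xM | apply: contra yM]; apply: Me.
by apply/negP => /(subsetP ME)/card_edge; rewrite cards0.
Qed.

Lemma maximal_matching_degreeE M : maximal_matching M =
  matching M && [forall x, forall y, adj x y ==> (0 < degree M x) || (0 < degree M y)].
Proof.
apply/maxsetP/andP => -[mM maxM]; split=> //.
  apply/'forall_forallP => x y; apply/implyP => xy; rewrite !degree_gt0.
  apply/norP => -[xM yM].
  have xyM : [set x; y] \in M.
    by rewrite -(maxM _ (matching_setU1 mM xy xM yM)) ?subsetUr ?setU11.
  by case/bigcupP: xM; exists [set x; y]; rewrite ?set21.
move=> B /andP[BE /trivIsetP tB] MB; apply/eqP; rewrite eqEsubset MB andbT.
apply/subsetP => e eB; have /mem_edgesP[[x y] /= xy eE] := subsetP BE e eB.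
suff [f fM [z zf ze]] : exists2 f, f \in M & exists2 z, z \in f & z \in e.
  have [-> //|ef] := eqVneq e f.
  by have := disjointFr (tB e f eB (subsetP MB f fM) ef) ze; rewrite zf.
have := forallP (forallP maxM x) y; rewrite xy !degree_gt0 eE.
case/orP => /bigcupP[f fM zf]; exists f => //; [exists x | exists y] => //.
  exact: set21.
exact: set22.
Qed.

End MaximalMatchings.
Section MaximalMatchingPoly.
Variables (R : comNzRingType) (G : sgraph).
Local Open Scope ring_scope.

Definition maximal_matching_poly : {poly R} :=
  \sum_(M : {set {set G}} | maximal_matching M) 'X^#|M|.

Lemma maximal_matching_poly_horner1 : maximal_matching_poly.[1] = (T0 G)%:R.
Proof.
rewrite horner_sum (eq_bigr (fun=> 1)); last by move=> M _; rewrite hornerXn expr1n.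
by rewrite /T0 -sum1dep_card natr_sum.
Qed.

Lemma maximal_matching_poly_deriv1 : maximal_matching_poly^`().[1] = (T1 G)%:R.
Proof.
rewrite raddf_sum horner_sum /T1 natr_sum; apply: eq_bigr => M _ /=.
by rewrite derivXn hornerMn hornerXn expr1n.
Qed.

End MaximalMatchingPoly.

Lemma sum_tuple_cons (V : nmodType) (T : finType) n (F : n.+1.-tuple T -> V) :
  (\sum_w F w = \sum_(a : T) \sum_(w : n.-tuple T) F [tuple of a :: w])%R.
Proof.
rewrite pair_bigA /=.
rewrite (reindex (fun p : T * n.-tuple T => [tuple of p.1 :: p.2])) //=.
exists (fun w : n.+1.-tuple T => (thead w, [tuple of behead w])) => [[a w]|w] _.
  by congr (_, _); apply: val_inj.
by rewrite /= -tuple_eta.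
Qed.

Lemma sum_tuple0 (V : nmodType) (T : finType) (F : 0.-tuple T -> V) :
  (\sum_w F w = F [tuple])%R.
Proof. by rewrite (big_pred1 [tuple]) // => w; apply/esym/eqP/tuple0. Qed.

Section WeightedWords.
Variables (R : pzSemiRingType) (A : finType) (state : Type).
Variables (allowed : state -> pred A) (next : A -> state) (final : pred state).
Variable weight : A -> R.
Local Open Scope ring_scope.

Fixpoint accepts (c : state) (w : seq A) : bool :=
  if w is a :: w' then allowed c a && accepts (next a) w' else final c.

Lemma accepts_path a w : accepts (next a) w =
  path (fun b => allowed (next b)) a w && final (next (last a w)).
Proof. by elim: w a => //= b w IH a; rewrite IH andbA. Qed.

Definition word_sum (c : state) n : R :=
  \sum_(w : n.-tuple A | accepts c w) \prod_(a <- w) weight a.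

Lemma word_sum0 c : word_sum c 0 = (final c)%:R.
Proof.
by rewrite /word_sum big_mkcond sum_tuple0 /= big_nil; case: (final c).
Qed.

Lemma word_sumS c n : word_sum c n.+1 =
  \sum_(a | allowed c a) weight a * word_sum (next a) n.
Proof.
rewrite /word_sum big_mkcond sum_tuple_cons [RHS]big_mkcond /=.
apply: eq_bigr => a _; case: (allowed c a) => /=; last by rewrite big1_eq.
rewrite mulr_sumr [RHS]big_mkcond /=.
by apply: eq_bigr => w _; rewrite big_cons.
Qed.

End WeightedWords.

(* Bits 0-3 are the cycle edges [j, j+1 mod 4]; bit 4 is the link leaving the
   cycle from vertex [s]. *)
Definition block := 5.-tuple bool.

Local Notation bit := (nth false).

(* [l] tells whether the link entering the cycle at vertex 0 is used. *)
Definition block_degree (s : nat) (l : bool) (b : seq bool) (j : nat) : nat :=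
  bit b j + bit b ((j + 3) %% 4) + (j == s) * bit b 4 + (j == 0) * l.

(* Whether the link leaving a cycle is used, and whether its first endpoint is
   covered. *)
Definition interface : Type := bool * bool.

Local Notation linked := (true, true).
Local Notation covered := (false, true).
Local Notation exposed := (false, false).

Definition out_interface (s : nat) (b : block) : interface :=
  (bit b 4, 0 < block_degree s false b s).

Definition fits (s : nat) (c : interface) (b : block) : bool :=
  let deg := block_degree s c.1 b in
  [&& all (fun j => deg j <= 1) (iota 0 4),
      all (fun j => (0 < deg j) || (0 < deg (j.+1 %% 4))) (iota 0 4) &
      c.2 || (0 < deg 0)].

(* The first cycle behaves as if it followed this perfect matching of a 4-cycle,
   which imposes no condition on it. *)
Definition rim : block := [tuple true; false; true; false; false].

Definition good_word (s : nat) : interface -> seq block -> bool :=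
  accepts (fits s) (out_interface s) (fun c => ~~ c.1).

Lemma sum_block (V : nmodType) (F : block -> V) :
  (\sum_b F b = \sum_(e0 : bool) \sum_(e1 : bool) \sum_(e2 : bool) \sum_(e3 : bool)
                  \sum_(l : bool) F [tuple e0; e1; e2; e3; l])%R.
Proof.
do 5 (rewrite sum_tuple_cons; apply: eq_bigr => ? _).
by rewrite sum_tuple0; congr F; apply: val_inj.
Qed.

Section TransferRecurrence.
Variable R : comNzRingType.
Local Open Scope ring_scope.
Implicit Types (s n : nat) (c : interface).

Definition word_poly s : interface -> nat -> {poly R} :=
  word_sum (fits s) (out_interface s) (fun c => ~~ c.1)
    (fun b : block => 'X^(count id b)).

Lemma word_poly0 s c : word_poly s c 0 = (~~ c.1)%:R.
Proof. exact: word_sum0. Qed.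

Lemma word_polyS s c n : word_poly s c n.+1 =
  \sum_(b : block | fits s c b) 'X^(count id b) * word_poly s (out_interface s b) n.
Proof. exact: word_sumS. Qed.

Lemma word_poly1_rec n :
  [/\ word_poly 1 linked n.+1 =
        'X^2 * word_poly 1 linked n + 'X * word_poly 1 covered n +
        'X * word_poly 1 exposed n,
      word_poly 1 covered n.+1 =
        2 * 'X^2 * (word_poly 1 linked n + word_poly 1 covered n) &
      word_poly 1 exposed n.+1 =
        'X^2 * (word_poly 1 linked n + 2 * word_poly 1 covered n)].
Proof.
by split; rewrite word_polyS big_mkcond sum_block !big_bool;
  rewrite /= /fits /block_degree /out_interface /block_degree /=;
  rewrite !(addn0, add0n, mul1n, mul0n, muln0, addr0, add0r) /=; ring.
Qed.

(* The interface [exposed] never arises for [s = 2]: leaving vertex 2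
   uncovered would force both neighbours 1 and 3 to be matched to vertex 0. *)
Lemma word_poly2_rec n :
  word_poly 2 linked n.+1 =
    'X * (word_poly 2 linked n + 2 * word_poly 2 covered n) /\
  word_poly 2 covered n.+1 =
    2 * 'X^2 * (word_poly 2 linked n + word_poly 2 covered n).
Proof.
by split; rewrite word_polyS big_mkcond sum_block !big_bool;
  rewrite /= /fits /block_degree /out_interface /block_degree /=;
  rewrite !(addn0, add0n, mul1n, mul0n, muln0, addr0, add0r) /=; ring.
Qed.

End TransferRecurrence.

Section C4chainEncoding.
Variable s : nat.
Hypothesis s_range : 0 < s < 4.

Definition coord m n (v : 'I_m * 'I_n) : nat * nat := (val v.1, val v.2).

Definition source (x : nat * nat) : nat * nat := (x.1, if x.2 < 4 then x.2 else s).

Definition target (x : nat * nat) : nat * nat :=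
  if x.2 < 4 then (x.1, x.2.+1 %% 4) else (x.1.+1, 0).

(* For the last cycle, code 4 yields a singleton, which is not an edge; this
   keeps [edge_of] total and injective. *)
Definition edge_of n (x : 'I_n * 'I_5) : {set C4chain s n} :=
  [set v : 'I_n * 'I_4 | coord v \in [:: source (coord x); target (coord x)]].

Let s_gt0 : 0 < s. Proof. by case/andP: s_range. Qed.

Let s_lt4 : s < 4. Proof. by case/andP: s_range. Qed.

Lemma coord_inj m n : injective (@coord m n).
Proof. by move=> [i j] [k l] [/val_inj -> /val_inj ->]. Qed.

Lemma coord_surj m n p : p.1 < m -> p.2 < n -> exists v : 'I_m * 'I_n, coord v = p.
Proof. by case: p => i j im jn; exists (Ordinal im, Ordinal jn). Qed.

Lemma mem_edge_of n (x : 'I_n * 'I_5) (v : 'I_n * 'I_4) :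
  (v \in edge_of x) = (coord v == source (coord x)) || (coord v == target (coord x)).
Proof. by rewrite !inE. Qed.

Lemma edge_of_inj n : injective (@edge_of n).
Proof.
move=> x y xy.
have memE p : p.1 < n -> p.2 < 4 ->
    (p == source (coord x)) || (p == target (coord x)) =
    (p == source (coord y)) || (p == target (coord y)).
  by move=> pn p4; have [v <-] := coord_surj pn p4; rewrite -!mem_edge_of xy.
have source_lt4 z : (source z).2 < 4 by rewrite /source /=; case: ifP.
have col_le p z : (p == source z) || (p == target z) -> z.1 <= p.1.
  by case/orP => /eqP -> //; rewrite /target; case: ifP => //=.
have ij : val x.1 = val y.1.
  apply/eqP; rewrite eqn_leq; apply/andP; split.
    by apply: (col_le (source (coord y)) (coord x)); rewrite memE ?ltn_ord // eqxx.
  by apply: (col_le (source (coord x)) (coord y)); rewrite -memE ?ltn_ord // eqxx.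
have row q : q < 4 ->
    (q == (source (coord x)).2) || (q == (target (coord x)).2) && (x.2 < 4) =
    (q == (source (coord y)).2) || (q == (target (coord y)).2) && (y.2 < 4).
  move=> q4; have := memE (val x.1, q) (ltn_ord _) q4.
  rewrite /source /target /coord /= -ij.
  by do 2 case: ifP => _;
    rewrite !xpair_eqE !eqxx /= ?(ltn_eqF (ltnSn _)) ?andbT ?andbF.
case: x y {xy memE} ij row => [i k] [j l] /= /val_inj -> row.
congr (_, _); apply: val_inj; move: (row 0 isT) (row 1 isT) (row 2 isT) (row 3 isT).
rewrite /source /target /coord /= => {row}.
case: s s_range => [|[|[|[|?]]]] // _; case: k => [] [|[|[|[|[|?]]]]] // ?;
  by case: l => [] [|[|[|[|[|?]]]]].
Qed.

Definition runs_along n (x : 'I_n * 'I_5) (u v : C4chain s n) : Prop :=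
  coord u = source (coord x) /\ coord v = target (coord x).

Lemma C4chain_arc_code n (u v : C4chain s n) : C4chain_arc s u v ->
  exists x, runs_along x u v \/ runs_along x v u.
Proof.
case: u v => [i j] [p q]; rewrite /runs_along /C4chain_arc /coord /source /target /=.
case/orP => [/andP[/eqP <-]|/and3P[/eqP ip /eqP js /eqP q0]]; last first.
  by exists (i, ord_max); rewrite /= ip js q0; left.
rewrite !inE !xpair_eqE => /or4P[] /andP[/eqP -> /eqP ->];
  [exists (i, inord 0) | exists (i, inord 1)
  | exists (i, inord 2) | exists (i, inord 3)];
  by rewrite /= !inordK //=; auto.
Qed.

Lemma adj_of_runs_along n (x : 'I_n * 'I_5) (u v : C4chain s n) :
  runs_along x u v -> adj u v.
Proof.
case: x u v => [i k] [i1 j1] [i2 j2]; rewrite /runs_along /source /target /coord /=.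
case=> -[i1i j1k]; rewrite /C4chain_adj /C4chain_arc /= -!val_eqE /= i1i j1k {j1k}.
case: ifP => k4 [-> ->]; rewrite !eqxx /= ?orbT //.
by rewrite (gtn_eqF (ltnSn i)) /= !orbF; case: k k4 => [] [|[|[|[|k]]]].
Qed.

Lemma C4chain_adjP n (u v : C4chain s n) :
  reflect (exists x, runs_along x u v \/ runs_along x v u) (adj u v).
Proof.
apply: (iffP idP) => [/orP[/C4chain_arc_code //|/C4chain_arc_code [x vu]]|[x]].
  by exists x; case: vu; [right | left].
by case=> /adj_of_runs_along; rewrite // adj_sym.
Qed.

Lemma edge_of_runs_along n (x : 'I_n * 'I_5) (u v : C4chain s n) :
  runs_along x u v -> edge_of x = [set u; v].
Proof.
case=> ux vx; apply/setP => z; rewrite mem_edge_of !inE -ux -vx.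
by rewrite !(inj_eq (@coord_inj _ _)).
Qed.

Definition code_valid n (x : 'I_n * 'I_5) : bool := (target (coord x)).1 < n.

Lemma runs_along_exists n (x : 'I_n * 'I_5) : code_valid x ->
  exists u v : C4chain s n, runs_along x u v.
Proof.
move=> x_valid.
have [u ux] : exists u : 'I_n * 'I_4, coord u = source (coord x).
  by apply: coord_surj; rewrite /= ?ltn_ord //; case: ifP; rewrite ?s_lt4.
have [v vx] : exists v : 'I_n * 'I_4, coord v = target (coord x).
  by apply: coord_surj => //; rewrite /target; case: ifP => //= _; rewrite ltn_mod.
by exists u, v.
Qed.

Lemma runs_along_valid n (x : 'I_n * 'I_5) (u v : C4chain s n) :
  runs_along x u v -> code_valid x.
Proof. by case=> _ vx; rewrite /code_valid -vx ltn_ord. Qed.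

Lemma edges_C4chainP n (e : {set C4chain s n}) :
  reflect (exists2 x, code_valid x & e = edge_of x) (e \in edges (C4chain s n)).
Proof.
apply: (iffP (mem_edgesP e)) => [[[u v] /= /C4chain_adjP[x uvx] ->]|[x]].
  exists x; case: uvx => uvx; first exact: runs_along_valid uvx.
  - exact: runs_along_valid uvx.
  - by rewrite (edge_of_runs_along uvx).
  - by rewrite (edge_of_runs_along uvx) setUC.
move=> /runs_along_exists[u [v uvx]] ->; exists (u, v).
  exact: adj_of_runs_along uvx.
exact: edge_of_runs_along.
Qed.

Lemma edge_of_edges n (x : 'I_n * 'I_5) :
  (edge_of x \in edges (C4chain s n)) = code_valid x.
Proof.
apply/edges_C4chainP/idP => [[y y_valid /edge_of_inj ->] //|x_valid].
by exists x.
Qed.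

Definition word_edges n (w : n.-tuple block) : {set {set C4chain s n}} :=
  @edge_of n @: [set x : 'I_n * 'I_5 | tnth (tnth w x.1) x.2].

Definition edges_word n (M : {set {set C4chain s n}}) : n.-tuple block :=
  [tuple [tuple edge_of (i, k) \in M | k < 5] | i < n].

Lemma word_edgesK n : cancel (@word_edges n) (@edges_word n).
Proof.
move=> w; apply: eq_from_tnth => i; apply: eq_from_tnth => k; rewrite !tnth_mktuple.
by rewrite mem_imset ?inE //; apply: edge_of_inj.
Qed.

Lemma edges_wordK n (M : {set {set C4chain s n}}) :
  M \subset edges (C4chain s n) -> word_edges (edges_word M) = M.
Proof.
move=> /subsetP ME; apply/setP => e.
apply/imsetP/idP => [[[i k]]|eM]; first by rewrite inE !tnth_mktuple => ? ->.
have /edges_C4chainP[[i k] _ eE] := ME e eM.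
by exists (i, k); rewrite // inE !tnth_mktuple -eE.
Qed.

Lemma card_word_edges_filter n (w : n.-tuple block) (P : pred {set C4chain s n}) :
  #|[set e in word_edges w | P e]| =
  \sum_i \sum_k (tnth (tnth w i) k && P (edge_of (i, k))).
Proof.
have -> : [set e in word_edges w | P e] =
    @edge_of n @: [set x : 'I_n * 'I_5 | tnth (tnth w x.1) x.2 && P (edge_of x)].
  apply/setP => e; rewrite inE; apply/andP/imsetP => [[/imsetP[x]]|[x]].
    by rewrite inE => xw -> Px; exists x; rewrite // inE xw.
  by rewrite inE => /andP[xw Px] ->; rewrite imset_f ?inE.
rewrite card_imset; last exact: edge_of_inj.
rewrite pair_bigA -sum1dep_card big_mkcond /=.
by apply: eq_bigr => -[i k] _ /=; case: (_ && _).
Qed.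

Lemma card_word_edges n (w : n.-tuple block) :
  #|word_edges w| = \sum_(b <- w) count id b.
Proof.
have -> : word_edges w = [set e in word_edges w | true].
  by apply/setP => e; rewrite inE andbT.
rewrite card_word_edges_filter big_tuple; apply: eq_bigr => i _.
rewrite -sum1_count [RHS]big_mkcond big_tuple.
by apply: eq_bigr => k _; rewrite andbT /=; case: ifP.
Qed.

Lemma block_incidence (b : block) i p q : q < 4 ->
  \sum_k (tnth b k && ((p, q) \in [:: source (i, val k); target (i, val k)])) =
  (i == p) * block_degree s false b q + (i.+1 == p) * ((q == 0) * bit b 4).
Proof.
move=> q4; transitivity (\sum_(k < 5)
  (bit b k && ((p, q) \in [:: source (i, val k); target (i, val k)]))).
  by apply: eq_bigr => k _; rewrite (tnth_nth false).
rewrite !big_ord_recr big_ord0 /= /block_degree !inE !xpair_eqE /=.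
rewrite [p == i]eq_sym [p == i.+1]eq_sym.
case: b => [] [|b0 [|b1 [|b2 [|b3 [|b4 [|? ?]]]]]] //= _.
have [->|_] := eqVneq i p; rewrite ?(gtn_eqF (ltnSn p)); last case: (i.+1 == p).
all: case: s s_range => [|[|[|[|?]]]] //= _; case: q q4 => [|[|[|[|?]]]] //= _.
all: by case: b0; case: b1; case: b2; case: b3; case: b4.
Qed.

Definition word_degree (w : seq block) i j : nat :=
  block_degree s (bit (nth rim (rim :: w) i) 4) (nth rim w i) j.

Lemma degree_word_edges n (w : n.-tuple block) (v : C4chain s n) :
  degree (word_edges w) v = word_degree w (coord v).1 (coord v).2.
Proof.
case: v => p q; rewrite /degree card_word_edges_filter.
under eq_bigr => i _ do
  under eq_bigr => k _ do rewrite inE.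
under eq_bigr => i _ do rewrite block_incidence ?ltn_ord //.
rewrite big_split /= (bigD1 p) //= eqxx mul1n big1 => [|i]; last first.
  by rewrite -val_eqE => /negPf ->; rewrite mul0n.
rewrite addn0 /word_degree /block_degree (tnth_nth rim) muln0 addn0; congr (_ + _).
case: p => -[|p] p_lt /=; first by rewrite big1 ?muln0.
rewrite (bigD1 (Ordinal (ltnW p_lt))) //= eqxx mul1n (tnth_nth rim) big1 ?addn0 // => i.
by rewrite -val_eqE eqSS => /negPf ->; rewrite mul0n.
Qed.

Lemma out_interface_rim : out_interface s rim = covered.
Proof. by case: s s_range => [|[|[|[|?]]]]. Qed.

Lemma fits_word_degree (w : seq block) i : i < size w ->
  fits s (out_interface s (nth rim (rim :: w) i)) (nth rim w i) =
  [&& all (fun j => word_degree w i j <= 1) (iota 0 4),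
      all (fun j => (0 < word_degree w i j) || (0 < word_degree w i (j.+1 %% 4)))
        (iota 0 4) &
      [|| i == 0, 0 < word_degree w i.-1 s | 0 < word_degree w i 0]].
Proof.
have out_degree k : (out_interface s (nth rim w k)).2 = (0 < word_degree w k s).
  by rewrite /out_interface /word_degree /block_degree /= (gtn_eqF s_gt0) mul0n.
rewrite /fits; case: i => [|i] wi; last by rewrite /= -out_degree.
by rewrite -[nth rim (rim :: w) 0]/rim out_interface_rim.
Qed.

Lemma good_word_nthP (w : seq block) :
  reflect ((forall i, i < size w ->
              fits s (out_interface s (nth rim (rim :: w) i)) (nth rim w i)) /\
           ~~ bit (last rim w) 4)
    (good_word s covered w).
Proof.
rewrite -out_interface_rim /good_word accepts_path.
have follows := @pathP _ (fun a b : block => fits s (out_interface s a) b) rim w rim.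
by apply: (iffP andP) => -[/follows].
Qed.

Lemma word_edges_sub_edges n (w : n.-tuple block) :
  (word_edges w \subset edges (C4chain s n)) = ~~ bit (last rim w) 4.
Proof.
apply/subsetP/idP => [we|last_link e /imsetP[[i k]]].
  case: n w we => [|n] w we; first by rewrite tuple0.
  apply/negP => last_link; suff: code_valid (@ord_max n, @ord_max 4).
    by rewrite /code_valid /= ltnn.
  rewrite -edge_of_edges; apply/we/imset_f; rewrite inE (tnth_nth rim) (tnth_nth false).
  by rewrite -nth_last size_tuple in last_link.
rewrite inE (tnth_nth rim) (tnth_nth false) /= => ik ->; rewrite edge_of_edges.
rewrite /code_valid /target /=; case: ifP => //= /negbT; rewrite -leqNgt => k4.
have kE : val k = 4 by apply/eqP; rewrite eqn_leq -ltnS ltn_ord.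
rewrite ltn_neqAle ltn_ord andbT; apply: contra last_link => /eqP iE.
have nE : n.-1 = i by move: iE => /=; lia.
by move: ik; rewrite -nth_last size_tuple nE [nat_of_ord k]kE.
Qed.

Lemma adj_C4chain_forall n (D : nat -> nat -> bool) :
  (forall u v : C4chain s n, adj u v ->
     D (coord u).1 (coord u).2 || D (coord v).1 (coord v).2) <->
  (forall i, i < n -> all (fun j => D i j || D i (j.+1 %% 4)) (iota 0 4) /\
                      [|| i == 0, D i.-1 s | D i 0]).
Proof.
split=> [dom i i_lt|dom u v /C4chain_adjP[x]].
  have domx (x : 'I_n * 'I_5) : code_valid x ->
      D (source (coord x)).1 (source (coord x)).2 ||
      D (target (coord x)).1 (target (coord x)).2.
    move=> /runs_along_exists[u [v uv]].
    by have := dom u v (adj_of_runs_along uv); case: uv => -> ->.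
  split; last first.
    case: i i_lt => [|i] i_lt //=.
    exact: (domx (Ordinal (ltnW i_lt), ord_max)).
  apply/allP => j; rewrite mem_iota /= => j4.
  have := domx (Ordinal i_lt, Ordinal (ltnW j4 : j < 5)).
  by rewrite /code_valid /source /target /= j4 => /(_ i_lt).
suff domx u' v' : runs_along x u' v' ->
    D (coord u').1 (coord u').2 || D (coord v').1 (coord v').2.
  by case=> /domx //; rewrite orbC.
move=> uv; have := runs_along_valid uv; case: uv => -> ->; case: x => i k.
rewrite /code_valid /source /target /=; case: ifP => k4 /= i_lt.
  have [/allP/(_ k) + _] := dom i i_lt; apply; by rewrite mem_iota.
by have [_] := dom _ i_lt.
Qed.

Lemma maximal_word_edges n (w : n.-tuple block) :
  maximal_matching (word_edges w) = good_word s covered w.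
Proof.
rewrite maximal_matching_degreeE matching_degreeE word_edges_sub_edges.
apply/idP/good_word_nthP; rewrite size_tuple.
  case/andP => /andP[last_link /forallP deg1] /'forall_forallP dom; split=> // i i_lt.
  have [|cyc link] :=
      (adj_C4chain_forall n (fun i j => 0 < word_degree w i j)).1 _ i i_lt.
    by move=> u v uv; rewrite -!degree_word_edges; exact: implyP (dom u v) uv.
  rewrite fits_word_degree ?size_tuple //; apply/and3P; split=> //.
  apply/allP => j; rewrite mem_iota /= => j4.
  by have := deg1 (Ordinal i_lt, Ordinal j4); rewrite degree_word_edges.
case=> fit ->; apply/andP; split.
  apply/forallP => -[i j]; rewrite degree_word_edges.
  have := fit i (ltn_ord i); rewrite fits_word_degree ?size_tuple //.
  by case/and3P => /allP/(_ j) + _ _; apply; rewrite mem_iota /=.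
apply/'forall_forallP => u v; apply/implyP; rewrite !degree_word_edges.
apply: (adj_C4chain_forall n (fun i j => 0 < word_degree w i j)).2 => i i_lt.
by have := fit i i_lt; rewrite fits_word_degree ?size_tuple // => /and3P[].
Qed.

Lemma maximal_matching_poly_C4chain (R : comNzRingType) n :
  maximal_matching_poly R (C4chain s n) = word_poly R s covered n.
Proof.
rewrite /maximal_matching_poly (reindex_onto (@word_edges n) (@edges_word n)).
  apply: eq_big => w; first by rewrite word_edgesK eqxx andbT maximal_word_edges.
  by rewrite card_word_edges -prodrXr.
by move=> M; rewrite maximal_matching_degreeE => /andP[/andP[/edges_wordK]].
Qed.

Lemma nu_C4chain n : nu (C4chain s n) = n.*2.
Proof.
apply/eqP; rewrite eqn_leq; apply/andP; split.
  apply/bigmax_leqP => M /card_matching_le.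
  by rewrite /= card_prod !card_ord; lia.
pose rims : n.-tuple block := [tuple of nseq n rim].
have <- : #|word_edges rims| = n.*2.
  by rewrite card_word_edges big_nseq iter_addn_0 /= mul2n.
apply: (@leq_bigmax_cond _ (@matching _) (fun M => #|M|)).
suff : maximal_matching (word_edges rims).
  by rewrite maximal_matching_degreeE => /andP[].
rewrite maximal_word_edges; apply/good_word_nthP; rewrite size_tuple; split=> [i i_lt|].
  rewrite -[rim :: _]/(nseq n.+1 rim) !nth_nseq !if_same out_interface_rim.
  by case: s s_range => [|[|[|[|?]]]].
by rewrite -nth_last nth_nseq if_same.
Qed.

End C4chainEncoding.

Local Open Scope ring_scope.

Section ShiftPolynomial.
Variable R : comNzRingType.
Implicit Types (p q : {poly R}) (u : nat -> R).

(* The value at [n] of [p] applied to [u], where ['X] acts as the shift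
   [u |-> u \o S]. *)
Definition shift_poly u n p : R := \sum_(i < size p) p`_i * u (n + i)%N.

Lemma shift_poly_widen m u n p : (size p <= m)%N ->
  shift_poly u n p = \sum_(i < m) p`_i * u (n + i)%N.
Proof.
move=> pm; rewrite /shift_poly (big_ord_widen m (fun i => p`_i * u (n + i)%N)) //.
rewrite big_mkcond; apply: eq_bigr => i _.
by case: ltnP => // ?; rewrite nth_default ?mul0r.
Qed.

Lemma shift_poly_is_linear u n : scalar (shift_poly u n).
Proof.
move=> a p q; pose m := maxn (size p) (size q).
have [pm qm] : (size p <= m)%N /\ (size q <= m)%N by rewrite leq_maxl leq_maxr.
have apqm : (size (a *: p + q)%R <= m)%N.
  by rewrite (leq_trans (size_polyD _ _)) // geq_max (leq_trans (size_scale_leq _ _)).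
rewrite !(@shift_poly_widen m) // mulr_sumr -big_split /=.
by apply: eq_bigr => i _; rewrite coefD coefZ mulrDl mulrA.
Qed.

HB.instance Definition _ u n :=
  GRing.isLinear.Build R {poly R} R *%R (shift_poly u n) (shift_poly_is_linear u n).

Lemma shift_polyXM u n p : shift_poly u n ('X * p) = shift_poly u n.+1 p.
Proof.
rewrite (@shift_poly_widen (size p).+1).
  rewrite big_ord_recl coefXM mul0r add0r; apply: eq_bigr => i _.
  by rewrite coefXM /= addnS.
by rewrite (leq_trans (size_polyMleq _ _)) // size_polyX.
Qed.

Lemma shift_polyC u n a : shift_poly u n a%:P = a * u n.
Proof.
by rewrite (@shift_poly_widen 1) ?size_polyC_leq1 // big_ord1 coefC addn0.
Qed.

Lemma shift_polyXn u n k : shift_poly u n 'X^k = u (n + k)%N.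
Proof.
elim: k n => [|k IH] n; first by rewrite shift_polyC mul1r addn0.
by rewrite exprS shift_polyXM IH addSnnS.
Qed.

Lemma shift_poly_cons u n a p :
  shift_poly u n (cons_poly a p) = a * u n + shift_poly u n.+1 p.
Proof.
by rewrite cons_poly_def raddfD /= commr_polyX shift_polyXM shift_polyC addrC.
Qed.

Lemma shift_polyX u n : shift_poly u n 'X = u n.+1.
Proof. by rewrite -['X]expr1 shift_polyXn addn1. Qed.

Lemma shift_polyM u n p q :
  shift_poly u n (p * q) = shift_poly ((shift_poly u)^~ q) n p.
Proof.
elim/poly_ind: p n => [|p a IH] n; first by rewrite mul0r !raddf0.
rewrite mulrDl !raddfD /= mul_polyC linearZ shift_polyC commr_polyX -mulrA.
by rewrite !shift_polyXM IH.
Qed.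

End ShiftPolynomial.

Section PolynomialCoefficients.
Variable R : comNzRingType.
Implicit Types (chi : {poly {poly R}}) (Z : nat -> {poly R}).

Lemma shift_poly_horner chi Z n a :
  (shift_poly Z n chi).[a] =
  shift_poly (fun k => (Z k).[a]) n (map_poly (horner_eval a) chi).
Proof.
rewrite !(@shift_poly_widen _ (size chi)) ?size_poly // horner_sum.
by apply: eq_bigr => i _; rewrite hornerM coef_map.
Qed.

Lemma deriv_shift_poly_horner chi Z n a :
  (shift_poly Z n chi)^`().[a] =
  shift_poly (fun k => (Z k).[a]) n (map_poly (horner_eval a \o deriv) chi) +
  shift_poly (fun k => (Z k)^`().[a]) n (map_poly (horner_eval a) chi).
Proof.
rewrite !(@shift_poly_widen _ (size chi)) ?size_poly // -big_split /=.
rewrite raddf_sum /= horner_sum; apply: eq_bigr => i _.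
by rewrite derivM hornerD !hornerM coef_map coef_map_id0 //= !raddf0.
Qed.

Lemma horner_map_deriv chi a b :
  (map_poly (horner_eval a \o deriv) chi).[b] = (chi.[b%:P])^`().[a].
Proof.
rewrite (@horner_coef_wide _ (size chi)) ?size_poly // (horner_coef chi).
rewrite raddf_sum horner_sum; apply: eq_bigr => i _ /=.
rewrite coef_map_id0 /= ?raddf0 //.
by rewrite -polyC_exp derivM derivC mulr0 addr0 hornerM hornerC.
Qed.

End PolynomialCoefficients.

Local Open Scope classical_set_scope.

Section EventualBounds.
Variable R : realType.
Implicit Types (v : R^nat) (B : R).

Definition eventual_bound v B := \forall n \near \oo, `|v n| <= B.

Lemma cvg0_contracting_bounds v t : 0 <= t < 1 -> (exists B, eventual_bound v B) ->
  (forall B e, 0 < e -> eventual_bound v B -> eventual_bound v (e + t * B)) ->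
  v @ \oo --> 0.
Proof.
move=> /andP[t0 t1] v_bounded v_contract.
have infS : has_inf [set B | eventual_bound v B].
  split=> //; exists 0 => B [N _ NB].
  by rewrite (le_trans _ (NB N (leqnn N))).
set b := inf [set B | eventual_bound v B].
have b_le0 : b <= 0.
  rewrite leNgt; apply/negP => b0.
  pose e := b * (1 - t) / 4.
  have e0 : 0 < e by rewrite divr_gt0 // mulr_gt0 // subr_gt0.
  have [B vB Bb] := inf_adherent e0 infS.
  have := ge_inf infS.2 (v_contract _ _ e0 vB).
  have := ler_wpM2l t0 (ltW Bb); have := ler_wpM2r (ltW e0) (ltW t1).
  by rewrite -/b mul1r mulrDr; move: e0; rewrite /e; lra.
apply/cvgrPdist_le => e /inf_adherent /(_ infS) [B vB Be].
near=> n; rewrite sub0r normrN (@le_trans _ _ B) //; first by near: n.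
lra.
Unshelve. all: by end_near. Qed.

Section DominatedRecurrence.
Variables (d : nat) (c v : R^nat).
Let f n := \sum_(i < d.+1) c i * v (n + i)%N.
Let A := \sum_(i < d) `|c i|.
Hypotheses (c_dominated : A < `|c d|) (f0 : f @ \oo --> 0).

Let A_ge0 : 0 <= A. Proof. exact: sumr_ge0. Qed.

Let cd_gt0 : 0 < `|c d|. Proof. exact: le_lt_trans c_dominated. Qed.

Let eventual_bound_f e : 0 < e -> eventual_bound f e.
Proof.
move=> e0; move/cvgrPdist_le: f0 => /(_ e e0); apply: filterS => n.
by rewrite sub0r normrN.
Qed.

Lemma dominated_recurrence_step n B :
  (forall i, (i < d)%N -> `|v (n + i)%N| <= B) ->
  `|c d| * `|v (n + d)%N| <= `|f n| + A * B.
Proof.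
move=> vB; rewrite -normrM.
have -> : c d * v (n + d)%N = f n - \sum_(i < d) c i * v (n + i)%N.
  by rewrite /f big_ord_recr /=; ring.
rewrite (le_trans (ler_normB _ _)) // lerD2l (le_trans (ler_norm_sum _ _ _)) //.
by rewrite /A mulr_suml ler_sum // => i _; rewrite normrM ler_wpM2l ?vB.
Qed.

Lemma dominated_recurrence_contracting B e : 0 < e -> eventual_bound v B ->
  eventual_bound v (e + A / `|c d| * B).
Proof.
move=> e0 [K _ vK]; have [N _ fN] := eventual_bound_f (mulr_gt0 e0 cd_gt0).
exists (N + K + d)%N => //= n /= nN; have dn : (d <= n)%N by lia.
rewrite -(ler_pM2l cd_gt0) -(subnK dn) (le_trans (@dominated_recurrence_step _ B _)) //.
  by move=> i _; apply: vK => /=; lia.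
rewrite mulrDr mulrA mulrCA divff ?mulr1 ?lt0r_neq0 // lerD2r mulrC.
by apply: fN => /=; lia.
Qed.

Lemma dominated_recurrence_bounded : exists B, eventual_bound v B.
Proof.
have cA_gt0 : 0 < `|c d| - A by rewrite subr_gt0.
have [N _ fN] := eventual_bound_f cA_gt0.
pose B := 1 + \sum_(i < d) `|v (N + i)%N|.
have B_ge1 : 1 <= B by rewrite lerDl sumr_ge0.
exists B, N => //= n /subnKC <-; elim/ltn_ind: (n - N)%N => m IH.
have [md|dm] := ltnP m d.
  by rewrite /B (bigD1 (Ordinal md)) //= addrCA lerDl addr_ge0 ?sumr_ge0.
rewrite -(ler_pM2l cd_gt0) -(subnK dm) addnA.
rewrite (le_trans (@dominated_recurrence_step _ B _)) // => [i id|].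
  by rewrite -addnA IH //; lia.
by have := fN (N + (m - d))%N (leq_addr _ _); have := ler_wpM2l (ltW cA_gt0) B_ge1; lra.
Qed.

Lemma cvg0_dominated_recurrence : v @ \oo --> 0.
Proof.
apply: cvg0_contracting_bounds dominated_recurrence_bounded
  dominated_recurrence_contracting.
by rewrite divr_ge0 ?A_ge0 //= ltr_pdivrMr // mul1r.
Qed.

End DominatedRecurrence.
End EventualBounds.

Section GeometricGrowth.
Variable R : realType.
Implicit Types (q g : {poly R}) (r l : R) (u : R^nat).

Definition lead_dominates q r :=
  \sum_(i < (size q).-1) `|q`_i * r ^+ i| < `|lead_coef q * r ^+ (size q).-1|.

Lemma lead_dominates_horner_neq0 q r : lead_dominates q r -> q.[r] != 0.
Proof.
rewrite /lead_dominates; apply: contraTneq => qr0; rewrite -leNgt.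
move: qr0; rewrite (horner_coef_wide _ (leqSpred _)) big_ord_recr /= -lead_coefE.
move=> /addr0_eq <-.
by rewrite normrN ler_norm_sum.
Qed.

Lemma cvg_shift_poly_geometric q r u l : r != 0 ->
  (fun n => u n / r ^+ n) @ \oo --> l ->
  (fun n => shift_poly u n q / r ^+ n) @ \oo --> q.[r] * l.
Proof.
move=> r0 ul.
have qE n : shift_poly u n q / r ^+ n =
    \sum_(i < size q) q`_i * r ^+ i * (u (n + i)%N / r ^+ (n + i)).
  rewrite mulr_suml; apply: eq_bigr => i _; rewrite exprD.
  by field; rewrite !expf_neq0.
rewrite horner_coef mulr_suml; under eq_cvg do rewrite qE.
apply: cvg_big => [|i _]; first exact: add_continuous.
apply: cvgMl_tmp; apply: (cvg_comp (fun n => (n + i)%N) (fun n => u n / r ^+ n)) ul.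
exact: cvg_addnr.
Qed.

Lemma cvg_geometric_of_shift_poly q r u l : r != 0 -> lead_dominates q r ->
  (fun n => shift_poly u n q / r ^+ n) @ \oo --> l ->
  (fun n => u n / r ^+ n) @ \oo --> l / q.[r].
Proof.
move=> r0 q_dom ul; have qr0 := lead_dominates_horner_neq0 q_dom.
set L := l / q.[r]; have lE : l = q.[r] * L by rewrite mulrC divfK.
pose v n := u n / r ^+ n - L.
have vE n : \sum_(i < (size q).-1.+1) q`_i * r ^+ i * v (n + i)%N =
    shift_poly u n q / r ^+ n - l.
  rewrite lE (horner_coef_wide _ (leqSpred _)) (shift_poly_widen _ _ (leqSpred _)).
  rewrite !mulr_suml -sumrB; apply: eq_bigr => i _; rewrite /v exprD.
  by field; rewrite !expf_neq0.
suff v0 : v @ \oo --> 0.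
  have uE n : u n / r ^+ n = v n + L by rewrite subrK.
  by under eq_cvg do rewrite uE; have := cvgD v0 (cvg_cst L); rewrite add0r; apply.
apply: (@cvg0_dominated_recurrence _ (size q).-1 (fun i => q`_i * r ^+ i)) => //.
under eq_cvg do rewrite vE.
by have := cvgB ul (cvg_cst l); rewrite subrr; apply.
Qed.

Lemma cesaro_increments u l :
  (fun n => u n.+1 - u n) @ \oo --> l -> (fun n => u n / n%:R) @ \oo --> l.
Proof.
move=> /cesaro increments; rewrite -cvg_shiftS /=.
have u0 : (fun n => u 0%N * n.+1%:R^-1) @ \oo --> 0.
  by rewrite -(mulr0 (u 0%N)); apply: cvgMl_tmp; exact: cvg_harmonic.
rewrite -[l]addr0; apply: cvg_trans (cvgD increments u0); apply: near_eq_cvg.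
near=> n; rewrite /arithmetic_mean /= seriesEnat.
transitivity (n.+1%:R^-1 * \sum_(0 <= k < n.+1) (u k.+1 - u k) + u 0%N / n.+1%:R) => //.
by rewrite telescope_sumr //; ring.
Unshelve. all: by end_near. Qed.

Lemma shift_poly_XsubC_geometric q r u n :
  (forall k, shift_poly u k (('X - r%:P) * q) = 0) ->
  shift_poly u n q = shift_poly u 0 q * r ^+ n.
Proof.
move=> uE; elim: n => [|n IH]; first by rewrite mulr1.
have /eqP := uE n; rewrite mulrBl raddfB /= shift_polyXM mul_polyC linearZ.
by rewrite subr_eq0 /= IH => /eqP ->; rewrite exprS mulrCA.
Qed.

(* Resonance: ['X - r] also divides the recurrence that makes [Y] grow like [r ^+ n],
   so [P n / r ^+ n] is unbounded. *)
Lemma cvg_resonant_growth q g r l (Y P : R^nat) : r != 0 -> lead_dominates q r ->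
  (fun n => Y n / r ^+ n) @ \oo --> l ->
  (forall n, shift_poly P n (('X - r%:P) * q) = shift_poly Y n g) ->
  (fun n => P n / r ^+ n / n%:R) @ \oo --> g.[r] * l / q.[r] / r.
Proof.
move=> r0 q_dom Yl PE; pose D n := P n.+1 - r * P n.
have Dl : (fun n => D n / r ^+ n) @ \oo --> g.[r] * l / q.[r].
  apply: cvg_geometric_of_shift_poly => //.
  have DE n : shift_poly D n q = shift_poly Y n g.
    rewrite -PE mulrC shift_polyM; apply: eq_bigr => i _; congr (_ * _).
    by rewrite raddfB /= shift_polyX shift_polyC.
  under eq_cvg do rewrite DE.
  exact: cvg_shift_poly_geometric.
have incrementE n : P n.+1 / r ^+ n.+1 - P n / r ^+ n = D n / r ^+ n * r^-1.
  by rewrite /D exprS; field; rewrite r0 expf_neq0.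
apply: cesaro_increments; under eq_cvg do rewrite incrementE.
exact: cvgM Dl (cvg_cst _).
Qed.

Lemma cvg_resonant_ratio q g r (Y P : R^nat) : r != 0 -> lead_dominates q r ->
  (forall n, shift_poly Y n (('X - r%:P) * q) = 0) ->
  (forall n, shift_poly P n (('X - r%:P) * q) = shift_poly Y n g) ->
  shift_poly Y 0 q != 0 ->
  (fun n => P n / (n%:R * Y n)) @ \oo --> g.[r] / (r * q.[r]).
Proof.
move=> r0 q_dom YE PE; set K := shift_poly Y 0 q => K0.
have qr0 := lead_dominates_horner_neq0 q_dom.
pose l := K / q.[r]; have l0 : l != 0 by rewrite mulf_neq0 ?invr_neq0.
have Yl : (fun n => Y n / r ^+ n) @ \oo --> l.
  apply: cvg_geometric_of_shift_poly => //.
  under eq_cvg do rewrite (shift_poly_XsubC_geometric _ YE) mulfK ?expf_neq0 //.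
  exact: cvg_cst.
have ratioE n : P n / (n%:R * Y n) = P n / r ^+ n / n%:R * (Y n / r ^+ n)^-1.
  have rn0 : r ^+ n != 0 by rewrite expf_neq0.
  by rewrite !invfM invrK; move: n%:R^-1 (Y n)^-1 => a b; field.
have -> : g.[r] / (r * q.[r]) = g.[r] * l / q.[r] / r * l^-1.
  by field; rewrite r0 qr0 l0.
under eq_cvg do rewrite ratioE.
exact: cvgM (cvg_resonant_growth r0 q_dom Yl PE) (cvgV l0 Yl).
Qed.

(* By implicit differentiation, the limit is the logarithmic derivative at [a] of the
   branch of roots of [chi] through [r]. *)
Lemma cvg_log_derivative (chi : {poly {poly R}}) q r a (Z : nat -> {poly R}) :
  r != 0 -> lead_dominates q r ->
  (forall n, shift_poly Z n chi = 0) ->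
  map_poly (horner_eval a) chi = ('X - r%:P) * q ->
  shift_poly (fun n => (Z n).[a]) 0 q != 0 ->
  (fun n => (Z n)^`().[a] / (n%:R * (Z n).[a])) @ \oo -->
    - (chi.[r%:P])^`().[a] / (r * q.[r]).
Proof.
move=> r0 q_dom chiZ chi_a leading; rewrite -horner_map_deriv -hornerN.
apply: cvg_resonant_ratio => // n; rewrite -chi_a.
  by rewrite -shift_poly_horner chiZ horner0.
rewrite raddfN /=; apply/eqP; rewrite -addr_eq0 addrC.
by rewrite -deriv_shift_poly_horner chiZ deriv0 horner0.
Qed.

End GeometricGrowth.

Section CharacteristicPolynomials.
Variable R : comNzRingType.

(* The outer variable is the shift in the number of cycles, the inner one marks the
   edges of a matching. *)
Definition chain_char1 : {poly {poly R}} :=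
  'X^3 - (3 *: 'X^2) *: 'X^2 + (2 *: 'X^4 - 3 *: 'X^3) *: 'X - (2 *: 'X^5)%:P.

Definition chain_char2 : {poly {poly R}} :=
  'X^2 - ('X + 2 *: 'X^2) *: 'X - (2 *: 'X^3)%:P.

Lemma chain_char1_annihilates n :
  shift_poly (word_poly R 1 covered) n chain_char1 = 0.
Proof.
rewrite !(raddfB, raddfD) /= !linearZ /= shift_polyC shift_polyX !shift_polyXn.
rewrite addn3 addn2.
have [_ -> _] := word_poly1_rec R n.+2; have [-> -> _] := word_poly1_rec R n.+1.
by have [-> -> ->] := word_poly1_rec R n; rewrite -!mul_polyC; ring.
Qed.

Lemma chain_char2_annihilates n :
  shift_poly (word_poly R 2 covered) n chain_char2 = 0.
Proof.
rewrite !raddfB /= linearZ /= shift_polyC shift_polyX shift_polyXn addn2.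
have [_ ->] := word_poly2_rec R n.+1; have [-> ->] := word_poly2_rec R n.
by rewrite -!mul_polyC; ring.
Qed.

Lemma chain_char1_at1 :
  map_poly (horner_eval 1) chain_char1 = 'X^3 - 3 *: 'X^2 - 'X - 2%:P.
Proof.
rewrite /chain_char1 !(raddfB, raddfD) /= !map_polyZ !map_polyXn map_polyX map_polyC /=.
rewrite /horner_eval !(hornerD, hornerN, hornerZ, hornerXn) !expr1n -!mul_polyC.
by ring.
Qed.

Lemma chain_char2_at1 :
  map_poly (horner_eval 1) chain_char2 = 'X^2 - 3 *: 'X - 2%:P.
Proof.
rewrite /chain_char2 !raddfB /= map_polyZ map_polyXn map_polyX map_polyC /=.
rewrite /horner_eval !(hornerD, hornerZ, hornerXn, hornerX) !expr1n.
by rewrite -!mul_polyC; ring.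
Qed.

Lemma chain_char1_deriv_at1 r : (chain_char1.[r%:P])^`().[1] = - (6 * r ^+ 2 + r + 10).
Proof.
rewrite /chain_char1 !(hornerD, hornerN, hornerZ, hornerXn, hornerX, hornerC).
rewrite -!polyC_exp !derivE.
rewrite !(hornerD, hornerN, hornerZ, hornerMn, hornerM, hornerXn, hornerX, hornerC).
by rewrite !expr1n; ring.
Qed.

Lemma chain_char2_deriv_at1 r : (chain_char2.[r%:P])^`().[1] = - (5 * r + 6).
Proof.
rewrite /chain_char2 !(hornerD, hornerN, hornerZ, hornerXn, hornerX, hornerC).
rewrite -!polyC_exp !derivE.
rewrite !(hornerD, hornerN, hornerZ, hornerMn, hornerM, hornerXn, hornerX, hornerC).
by rewrite !expr1n; ring.
Qed.

Lemma word_poly1_init_at1 (w := word_poly R 1 covered) :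
  [/\ (w 0%N).[1] = 1, (w 1%N).[1] = 2 & (w 2%N).[1] = 8].
Proof.
rewrite /w; have [_ -> _] := word_poly1_rec R 1; have [-> -> _] := word_poly1_rec R 0.
rewrite !word_poly0 /=; split; rewrite !hornerE /= ?expr1n; ring.
Qed.

Lemma word_poly2_init_at1 (w := word_poly R 2 covered) :
  (w 0%N).[1] = 1 /\ (w 1%N).[1] = 2.
Proof.
rewrite /w; have [_ ->] := word_poly2_rec R 0; rewrite !word_poly0 /=.
by split; rewrite !hornerE /= ?expr1n; ring.
Qed.

End CharacteristicPolynomials.

Section Limits.
Variables (R : realType) (r : R).
Hypothesis r_gt0 : 0 < r.

Lemma cvg_avg_ratio_C4chain s (chi : {poly {poly R}}) (q : {poly R}) :
  (0 < s < 4)%N -> lead_dominates q r ->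
  (forall n, shift_poly (word_poly R s covered) n chi = 0) ->
  map_poly (horner_eval 1) chi = ('X - r%:P) * q ->
  shift_poly (fun n => (word_poly R s covered n).[1]) 0 q != 0 ->
  (fun n => avg_ratio R (C4chain s n)) @ \oo -->
    - (chi.[r%:P])^`().[1] / (2 * (r * q.[r])).
Proof.
move=> s_range q_dom chiZ chi1 leading.
have ratioE n : (T1 (C4chain s n))%:R / (n%:R * (T0 (C4chain s n))%:R) =
    (word_poly R s covered n)^`().[1] /
      (n%:R * (word_poly R s covered n).[1]) :> R.
  rewrite -maximal_matching_poly_C4chain // maximal_matching_poly_horner1.
  by rewrite maximal_matching_poly_deriv1.
have lim := cvg_log_derivative (lt0r_neq0 r_gt0) q_dom chiZ chi1 leading.
rewrite invfM mulrCA; apply: cvg_trans (cvgM (cvg_cst (2^-1 : R)) lim).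
apply: near_eq_cvg; near=> n; have n_gt0 : (0 < n)%N by near: n; exists 1%N.
rewrite /= -ratioE /avg_ratio nu_C4chain // double_eq0 gtn_eqF //.
by rewrite -mul2n natrM -[2 * _ * _]mulrA [in RHS]invfM mulrCA.
Unshelve. all: by end_near. Qed.

Lemma cvg_avg_ratio_C4chain1 : r ^+ 3 = 3 * r ^+ 2 + r + 2 ->
  (fun n => avg_ratio R (C4chain 1 n)) @ \oo -->
    (6 * r ^+ 2 + r + 10) / (2 * (3 * r ^+ 2 + 2 * r + 6)).
Proof.
move=> rE; pose q0 := r ^+ 2 - 3 * r - 1; pose q := Poly [:: q0; r - 3; 1].
have qE : q = [:: q0; r - 3; 1] :> seq R by rewrite (@PolyK _ 0) //= oner_eq0.
have rq0 : r * q0 = 2 by rewrite /q0 !mulrBr -exprS rE; ring.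
have q0_gt0 : 0 < q0 by rewrite -(pmulr_rgt0 _ r_gt0) rq0.
have r3_gt0 : 0 < r - 3.
  by rewrite -(pmulr_rgt0 _ r_gt0); move: q0_gt0; rewrite /q0; lra.
have q_dom : lead_dominates q r.
  rewrite /lead_dominates lead_coefE qE /= !big_ord_recl big_ord0 /= addr0.
  rewrite expr0 expr1 mulr1 mul1r !gtr0_norm ?mulr_gt0 ?exprn_gt0 //.
  by rewrite -(ltr_pM2l r_gt0) mulrDr rq0; nra.
have rqr : r * q.[r] = 3 * r ^+ 2 + 2 * r + 6.
  transitivity (2 * r ^+ 3 - 3 * r ^+ 2 + r * q0).
    by rewrite horner_Poly /=; ring.
  by rewrite rE rq0; ring.
rewrite -rqr -[6 * _ + _ + _]opprK -chain_char1_deriv_at1.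
apply: cvg_avg_ratio_C4chain q_dom (@chain_char1_annihilates R) _ _ => //.
  by rewrite chain_char1_at1 -rq0 /q /= !cons_poly_def -mul_polyC /q0; ring.
rewrite /q /= !shift_poly_cons raddf0.
have [-> -> ->] := word_poly1_init_at1 R; apply: lt0r_neq0.
by rewrite mulr1 mul1r addr0 addr_gt0 // addr_gt0 // mulr_gt0.
Qed.

Lemma cvg_avg_ratio_C4chain2 : r ^+ 2 = 3 * r + 2 ->
  (fun n => avg_ratio R (C4chain 2 n)) @ \oo --> (5 * r + 6) / (2 * (3 * r + 4)).
Proof.
move=> rE; pose q := Poly [:: r - 3; 1].
have qE : q = [:: r - 3; 1] :> seq R by rewrite (@PolyK _ 0) //= oner_eq0.
have rr3 : r * (r - 3) = 2 by rewrite mulrBr -expr2 rE; ring.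
have r3_gt0 : 0 < r - 3 by rewrite -(pmulr_rgt0 _ r_gt0) rr3.
have q_dom : lead_dominates q r.
  rewrite /lead_dominates lead_coefE qE /= big_ord1 /= expr0 expr1 mulr1 mul1r.
  by rewrite !gtr0_norm //; lra.
have rqr : r * q.[r] = 3 * r + 4.
  transitivity (2 * r ^+ 2 - 3 * r); first by rewrite horner_Poly /=; ring.
  by rewrite rE; ring.
rewrite -rqr -[5 * _ + _]opprK -chain_char2_deriv_at1.
apply: cvg_avg_ratio_C4chain q_dom (@chain_char2_annihilates R) _ _ => //.
  by rewrite chain_char2_at1 -rr3 /q /= !cons_poly_def -mul_polyC; ring.
rewrite /q /= !shift_poly_cons raddf0.
have [-> ->] := word_poly2_init_at1 R; apply: lt0r_neq0.
by rewrite !mulr1 mul1r addr0 addr_gt0.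
Qed.

End Limits.

Lemma cube_add_cbrt (R : realType) (x y : R) : 0 <= x -> 0 <= y ->
  (x `^ 3^-1 + y `^ 3^-1) ^+ 3 =
  x + y + 3 * (x * y) `^ 3^-1 * (x `^ 3^-1 + y `^ 3^-1).
Proof.
move=> x0 y0.
have cbrtK (z : R) : 0 <= z -> (z `^ 3^-1) ^+ 3 = z.
  by move=> z0; rewrite -powR_mulrn ?powR_ge0 // -powRrM mulVf // powRr1.
by rewrite -{2}(cbrtK x x0) -{2}(cbrtK y y0) powRM //; ring.
Qed.

Lemma chain_char1_root (R : realType)
    (r := 1 + ((45 + Num.sqrt 1257) / 18) `^ (3^-1)
            + ((45 - Num.sqrt 1257) / 18) `^ (3^-1) : R) :
  0 < r /\ r ^+ 3 = 3 * r ^+ 2 + r + 2.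
Proof.
pose s : R := Num.sqrt 1257.
have s2 : s ^+ 2 = 1257 by rewrite sqr_sqrtr ?ler0n.
have s_le45 : s <= 45 by rewrite -(@ler_pXn2r _ 2) ?nnegrE ?sqrtr_ge0 // s2; lra.
have x0 : 0 <= (45 + s) / 18 by rewrite divr_ge0 ?addr_ge0 ?sqrtr_ge0.
have y0 : 0 <= (45 - s) / 18 by rewrite divr_ge0 ?subr_ge0.
have xy : ((45 + s) / 18 * ((45 - s) / 18)) `^ 3^-1 = 4 / 3.
  have -> : (45 + s) / 18 * ((45 - s) / 18) = (4 / 3) `^ 3.
    transitivity ((45 ^+ 2 - s ^+ 2) / 18 ^+ 2); first by field.
    by rewrite s2 powR_mulrn //; field.
  by rewrite -powRrM mulfV ?powRr1.
have := cube_add_cbrt x0 y0; rewrite xy /r -/s.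
have := powR_ge0 ((45 + s) / 18) 3^-1; have := powR_ge0 ((45 - s) / 18) 3^-1.
move: (((45 + s) / 18) `^ _) (((45 - s) / 18) `^ _) => b c c0 b0 bc3.
split; first by lra.
transitivity ((b + c) ^+ 3 + (3 * (b + c) ^+ 2 + 3 * (b + c) + 1)); first by ring.
by rewrite bc3; field.
Qed.

Lemma chain_char2_root (R : realType) (r := (3 + Num.sqrt 17) / 2 : R) :
  0 < r /\ r ^+ 2 = 3 * r + 2.
Proof.
have s2 : Num.sqrt 17 ^+ 2 = 17 :> R by rewrite sqr_sqrtr ?ler0n.
have s_ge0 : 0 <= Num.sqrt 17 :> R by exact: sqrtr_ge0.
by split; rewrite /r; [lra | rewrite exprMn sqrrD s2; field].
Qed.

Theorem theorem5 (R : realType) :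
  (let r : R := 1 + ((45 + Num.sqrt 1257) / 18) `^ (3^-1)
                  + ((45 - Num.sqrt 1257) / 18) `^ (3^-1) in
   (fun n : nat => avg_ratio R (C4chain 1 n)) @ \oo -->
     (6 * r ^+ 2 + r + 10) / (2 * (3 * r ^+ 2 + 2 * r + 6)))
  /\
  (let r' : R := (3 + Num.sqrt 17) / 2 in
   (fun n : nat => avg_ratio R (C4chain 2 n)) @ \oo -->
     (5 * r' + 6) / (2 * (3 * r' + 4))).
Proof.
split; cbv zeta.
  by have [r_gt0 rE] := chain_char1_root R; apply: cvg_avg_ratio_C4chain1.
by have [r_gt0 rE] := chain_char2_root R; apply: cvg_avg_ratio_C4chain2.
Qed.
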